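(* For all $-\frac32<\alpha<\frac32$, and for all vector fields $u:\mathbb{R}^3\to\mathbb{R}^3$ that are divergence free in the sense that $\xi\cdot\hat u(\xi)=0$ for almost every $\xi\in\mathbb{R}^3$, $$\|S\|_{\dot H^\alpha}^2=\|A\|_{\dot H^\alpha}^2=\frac12\|\omega\|_{\dot H^\alpha}^2=\frac12\|\nabla\otimes u\|_{\dot H^\alpha}^2.$$
   Context: $\hat u$ is the Fourier transform of $u$ (assumed to be a function so that the divergence-free condition makes sense). $(\nabla\otimes u)_{ij}=\frac{\partial u_j}{\partial x_i}$; its symmetric part is $S_{ij}=\frac12\left(\frac{\partial u_j}{\partial x_i}+\frac{\partial u_i}{\partial x_j}\right)$ and its antisymmetric part is $A_{ij}=\frac12\left(\frac{\partial u_j}{\partial x_i}-\frac{\partial u_i}{\partial x_j}\right)$; $\omega=\nabla\times u$ is the vorticity. The homogeneous Sobolev norm is $\|f\|_{\dot H^s}^2=\langle f,(-\Delta)^sf\rangle=\|(-\Delta)^{s/2}f\|_{L^2}^2$, and matrices are measured in the Euclidean norm $|M|^2=\sum_{i,j=1}^3M_{ij}^2$. *)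

(* Defs.v *)
From HB Require Import structures.
From mathcomp Require Import all_boot all_order all_algebra.
From mathcomp Require Import complex.
From mathcomp Require Import all_classical all_reals all_analysis.
Set Implicit Arguments.
Unset Strict Implicit.
Unset Printing Implicit Defensive.
Import Order.TTheory GRing.Theory Num.Theory.
Import numFieldNormedType.Exports.
Local Open Scope classical_set_scope.
Local Open Scope ring_scope.
Local Open Scope complex_scope.

Section Euclidean_space.
Variable R : realType.
Local Notation E := 'rV[R]_3.

Definition dot (x y : E) : R := \sum_j x 0 j * y 0 j.

(* The library's norm on row vectors is the max norm. *)
Definition enorm (x : E) : R := Num.sqrt (dot x x).

Definition cabs (z : R[i]) : R := Num.sqrt (complex.Re z ^+ 2 + complex.Im z ^+ 2).

(* The library has product measures on R * R * R but no measure on row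
   vectors, so integration over R^3 goes through coordinates. *)
Definition lebesgue3 :
    set (measurableTypeR R * measurableTypeR R * measurableTypeR R) -> \bar R :=
  ((@lebesgue_measure R \x @lebesgue_measure R) \x @lebesgue_measure R)%E.
HB.instance Definition _ := Measure.on lebesgue3.

Definition vec3 (p : R * R * R) : E :=
  \row_(j < 3) nth 0 [:: p.1.1; p.1.2; p.2] j.

Definition integral3 (f : E -> R[i]) : R[i] :=
  Rintegral lebesgue3 setT (fun p => complex.Re (f (vec3 p))) +i*
  Rintegral lebesgue3 setT (fun p => complex.Im (f (vec3 p))).

Definition ae3 (P : E -> Prop) : Prop :=
  {ae lebesgue3, forall p, P (vec3 p)}.

Definition locally_integrable3 (g : E -> R[i]) : Prop :=
  forall r : R,
    lebesgue3.-integrable [set p | enorm (vec3 p) <= r]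
      (fun p => (complex.Re (g (vec3 p)))%:E) /\
    lebesgue3.-integrable [set p | enorm (vec3 p) <= r]
      (fun p => (complex.Im (g (vec3 p)))%:E).

End Euclidean_space.

Section Schwartz_functions.
Variable R : realType.
Local Notation E := 'rV[R]_3.
Implicit Types phi : E -> R[i].

Definition partial (j : 'I_3) phi : E -> R[i] := fun x =>
  'D_(delta_mx 0 j) (fun y => complex.Re (phi y)) x +i*
  'D_(delta_mx 0 j) (fun y => complex.Im (phi y)) x.

Definition partials (s : seq 'I_3) phi : E -> R[i] := foldr partial phi s.

Definition smooth phi : Prop :=
  forall (s : seq 'I_3) (x : E),
    differentiable (fun y => complex.Re (partials s phi y)) x /\
    differentiable (fun y => complex.Im (partials s phi y)) x.

Definition test_function phi : Prop :=
  smooth phi /\ exists r : R, forall x, r < enorm x -> phi x = 0.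

(* The N-th Schwartz seminorm of phi is at most B. *)
Definition seminorm_le (N : nat) phi (B : R) : Prop :=
  forall (s : seq 'I_3) (x : E), (size s <= N)%N ->
    (1 + enorm x) ^+ N * cabs (partials s phi x) <= B.

Definition schwartz phi : Prop :=
  smooth phi /\ forall N, exists B, seminorm_le N phi B.

Definition fourier phi : E -> R[i] := fun xi =>
  integral3 (fun x =>
    (cos (2 * pi * dot x xi) -i* sin (2 * pi * dot x xi)) * phi x).

End Schwartz_functions.

(* A distribution is given by its (bilinear, unconjugated) pairing with test
   functions; only its values on Schwartz functions are meaningful. *)
Definition distribution3 (R : realType) : Type := ('rV[R]_3 -> R[i]) -> R[i].

Section Tempered_distributions.
Variable R : realType.
Local Notation E := 'rV[R]_3.
Implicit Types T : distribution3 R.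

Definition tempered T : Prop :=
  (forall (a : R[i]) phi psi, schwartz phi -> schwartz psi ->
     T (fun x => a * phi x + psi x) = a * T phi + T psi) /\
  (exists (N : nat) (M : R), forall phi B,
     schwartz phi -> seminorm_le N phi B -> cabs (T phi) <= M * B).

Definition real_valued T : Prop :=
  forall phi, schwartz phi -> T (fun x => (phi x)^*) = (T phi)^*.

(* T is (the distribution defined by) the function g. *)
Definition is_function T (g : E -> R[i]) : Prop :=
  locally_integrable3 g /\
  forall phi, test_function phi -> T phi = integral3 (fun x => g x * phi x).

Definition dist_partial (j : 'I_3) T : distribution3 R :=
  fun phi => - T (partial j phi).

Definition dist_fourier T : distribution3 R := fun phi => T (fourier phi).

(* (-Delta)^s on the Fourier side: multiplication by |2 pi xi|^(2s). *)
Definition laplacian_power (s : R) (g : E -> R[i]) : E -> R[i] :=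
  fun xi => (((2 * pi * enorm xi) ^+ 2) `^ s)%:C * g xi.

(* ||f||^2 in homogeneous H^s, for a family f of tempered distributions
   (the entries of a vector or of a matrix) measured in the Euclidean norm:
   the squared L^2 norm of (-Delta)^(s/2) f, taken on the Fourier side, where
   (-Delta)^(s/2) is defined. The functions g representing the Fourier
   transform of f agree almost everywhere, so the infimum is over at most one
   value; it is +oo when the Fourier transform is not a function. *)
Definition sobolev_sqnorm (I : finType) (s : R) (f : I -> distribution3 R)
    : \bar R :=
  ereal_inf
    [set (\int[@lebesgue3 R]_p
            (\sum_i cabs (laplacian_power (s / 2) (g i) (vec3 p)) ^+ 2)%:E)%E
    | g in [set g : I -> E -> R[i] |
              forall i, is_function (dist_fourier (f i)) (g i)]].

End Tempered_distributions.

Section Vector_fields.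
Variable R : realType.
Variable u : 'I_3 -> distribution3 R.

Definition grad (ij : 'I_3 * 'I_3) : distribution3 R :=
  dist_partial ij.1 (u ij.2).

Definition strain (ij : 'I_3 * 'I_3) : distribution3 R := fun phi =>
  2^-1 * (dist_partial ij.1 (u ij.2) phi + dist_partial ij.2 (u ij.1) phi).

Definition antisym (ij : 'I_3 * 'I_3) : distribution3 R := fun phi =>
  2^-1 * (dist_partial ij.1 (u ij.2) phi - dist_partial ij.2 (u ij.1) phi).

(* Indices in 'I_3 are added modulo 3, as in the cyclic formula for curl. *)
Definition vorticity (i : 'I_3) : distribution3 R := fun phi =>
  dist_partial (i + 1) (u (i + 2%:R)) phi
  - dist_partial (i + 2%:R) (u (i + 1)) phi.

Definition divergence_free (uhat : 'I_3 -> 'rV[R]_3 -> R[i]) : Prop :=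
  ae3 (fun xi => \sum_j (xi 0 j)%:C * uhat j xi = 0).

End Vector_fields.

(* Main.v *)
Require Import Defs.
From mathcomp Require Import all_boot all_order all_algebra.
From mathcomp Require Import complex ring lra.
From mathcomp Require Import all_classical all_reals all_analysis.
From mathcomp Require Import measurable_realfun.

(** On the Fourier side differentiation is multiplication by a symbol, so each
    of the four norms is a weighted integral of a pointwise quadratic
    expression in the frequency xi and the vector v = uhat xi.  Up to the
    common factor (2 pi)^2 |2 pi xi|^(2 alpha), and with A denoting here the
    sum of the |xi_i v_j - xi_j v_i|^2 over all i and j, these expressions are
    |xi|^2 |v|^2 for the gradient, A / 2 = |xi x v|^2 for the vorticity, A / 4
    for the antisymmetric part and (A + 4 |xi . v|^2) / 4 for the strain.
    Lagrange's identity |xi x v|^2 = |xi|^2 |v|^2 - |xi . v|^2 and the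
    condition xi . v = 0 give all the equalities (sqabs_strain,
    sqabs_vorticity, sqabs_grad).

    Two analytic facts reduce the theorem to this computation.

    First, the Fourier transform of the i-th derivative of T is 2 pi i xi_i
    times that of T (is_function_partial).  By duality this is the identity
    partial_i (F phi) = F (- 2 pi i x_i phi) for a test function phi, which is
    differentiation under the integral sign (fourier_partial).  As x_i phi is
    again a test function, the function representing the Fourier transform of
    T gives the value of T at the right-hand side.

    Second, a norm defined as an infimum over all functions representing a
    distribution is the value at any one of them (sobolev_sqnormE).  This
    needs the fundamental lemma of the calculus of variations: two locally
    integrable functions with the same pairings agree almost everywhere
    (is_function_unique).  The indicator of an open box is the bounded limit,
    as c decreases to 0, of products of the functions exp(- c / (x_j - a_j))
    and exp(- c / (b_j - x_j)), extended by 0; hence a function orthogonal to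
    all test functions has integral 0 on every box, and, boxes being a
    pi-system that generates the measurable sets, on every bounded measurable
    set. *)

Set Implicit Arguments.
Unset Strict Implicit.
Unset Printing Implicit Defensive.
Import Order.TTheory GRing.Theory Num.Theory.
Import numFieldNormedType.Exports.
Local Open Scope classical_set_scope.
Local Open Scope ring_scope.
Local Open Scope complex_scope.

(** * Complex numbers and sums over three indices *)

Section Complex.
Variable R : realType.
Local Notation C := R[i].
Local Notation Re := complex.Re.
Local Notation Im := complex.Im.

Lemma ReD (z w : C) : Re (z + w) = Re z + Re w. Proof. by case: z w => ? ? []. Qed.
Lemma ImD (z w : C) : Im (z + w) = Im z + Im w. Proof. by case: z w => ? ? []. Qed.
Lemma ReM (z w : C) : Re (z * w) = Re z * Re w - Im z * Im w.
Proof. by case: z w => ? ? []. Qed.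
Lemma ImM (z w : C) : Im (z * w) = Re z * Im w + Im z * Re w.
Proof. by case: z w => ? ? []. Qed.
Lemma ReN (z : C) : Re (- z) = - Re z. Proof. by case: z. Qed.
Lemma ImN (z : C) : Im (- z) = - Im z. Proof. by case: z. Qed.

Lemma complexP (z w : C) : Re z = Re w -> Im z = Im w -> z = w.
Proof. by case: z w => ? ? [? ?] /= -> ->. Qed.

End Complex.

Section Three_indices.

Lemma ord3P (P : 'I_3 -> Prop) : P 0 -> P 1 -> P 2%:R -> forall j, P j.
Proof.
move=> P0 P1 P2 [[|[|[|//]]] i].
- by rewrite (_ : Ordinal i = 0)//; exact/val_inj.
- by rewrite (_ : Ordinal i = 1)//; exact/val_inj.
- by rewrite (_ : Ordinal i = 2%:R)//; exact/val_inj.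
Qed.

Lemma sum3 (V : nmodType) (F : 'I_3 -> V) : \sum_i F i = F 0 + F 1 + F 2%:R.
Proof.
rewrite !big_ord_recl big_ord0 addr0 addrA.
by congr (_ + F _ + F _); exact/val_inj.
Qed.

Lemma sum_pairs3 (V : nmodType) (F : 'I_3 * 'I_3 -> V) : \sum_ij F ij =
  F (0, 0) + F (0, 1) + F (0, 2%:R) + F (1, 0) + F (1, 1) + F (1, 2%:R) +
  F (2%:R, 0) + F (2%:R, 1) + F (2%:R, 2%:R).
Proof.
rewrite (eq_bigr (fun ij => F (ij.1, ij.2))); last by case.
by rewrite -(pair_bigA _ (fun i j => F (i, j))) /= !sum3 !addrA.
Qed.

End Three_indices.

(** * Boxes and measurability in three dimensions *)

Section Boxes.
Variable R : realType.
Local Notation E := 'rV[R]_3.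
Local Notation mR := (measurableTypeR R).
Local Notation R3 := (mR * mR * mR)%type.
Implicit Types (a b : 'I_3 -> R) (p : R3) (f : E -> R).

Lemma vec3E0 p : vec3 p 0 0 = p.1.1. Proof. by rewrite mxE. Qed.
Lemma vec3E1 p : vec3 p 0 1 = p.1.2. Proof. by rewrite mxE. Qed.
Lemma vec3E2 p : vec3 p 0 2%:R = p.2. Proof. by rewrite mxE. Qed.

Lemma measurable_coord3 (j : 'I_3) :
  measurable_fun setT (fun p : R3 => vec3 p 0 j : mR).
Proof.
elim/ord3P: j.
- under eq_fun do rewrite vec3E0; exact: measurableT_comp.
- under eq_fun do rewrite vec3E1; exact: measurableT_comp.
- under eq_fun do rewrite vec3E2; exact: measurable_snd.
Qed.

Definition box a b : set R3 := [set p | forall j, a j < vec3 p 0 j < b j].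

Lemma boxE a b : box a b = \bigcap_j [set p | vec3 p 0 j \in `]a j, b j[].
Proof.
by apply/seteqP; split=> p /= H j => [_|]; have:= H j; rewrite /= in_itv//; exact.
Qed.

Lemma measurable_box a b : measurable (box a b).
Proof.
rewrite boxE; apply: fin_bigcap_measurable => [|j _]; first exact: finite_finset.
have := measurable_coord3 j measurableT (measurable_itv `]a j, b j[).
by rewrite setTI.
Qed.

Lemma mx_ball_row (x y : E) (e : R) :
  0 < e -> (forall j, `|x 0 j - y 0 j| < e) -> ball x e y.
Proof. by move=> e0 H; split=> // i j; rewrite ord1; exact: H. Qed.

(** The sigma-algebra on triples is a product of Borel algebras, so open sets
    of row vectors enter it through a countable cover by rational boxes. *)
Lemma open_measurable3 (U : set E) :
  open U -> measurable [set p : R3 | U (vec3 p)].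
Proof.
move=> oU.
pose lo (q : {ffun 'I_3 -> rat * rat}) := fun j : 'I_3 => ratr (q j).1 : R.
pose hi (q : {ffun 'I_3 -> rat * rat}) := fun j : 'I_3 => ratr (q j).2 : R.
pose inside (q : {ffun 'I_3 -> rat * rat}) :=
  box (lo q) (hi q) `<=` [set p : R3 | U (vec3 p)].
rewrite (_ : [set _ | _] =
    \bigcup_q (if `[< inside q >] then box (lo q) (hi q) else set0)).
  apply: countable_bigcupT_measurable => [|q]; first exact: countableP.
  by case: ifP => _ //; exact: measurable_box.
apply/seteqP; split => [p /= Up|p [q _]]; last first.
  by case: ifPn => // /asboolP; exact.
have /nbhs_ballP[e /= e0 eU] : nbhs (vec3 p) U by exact: open_nbhs_nbhs.
have lt1 (j : 'I_3) : vec3 p 0 j - e < vec3 p 0 j by rewrite ltrBlDr ltrDl.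
have lt2 (j : 'I_3) : vec3 p 0 j < vec3 p 0 j + e by rewrite ltrDl.
have [ql qlP] := choice (fun j => rat_in_itvoo (lt1 j)).
have [qh qhP] := choice (fun j => rat_in_itvoo (lt2 j)).
exists [ffun j => (ql j, qh j)] => //; rewrite ifT; last first.
  apply/asboolP => p' p'box /=; apply: eU; apply: mx_ball_row => // j.
  have := p'box j; have:= qlP j; have:= qhP j.
  rewrite /lo /hi ffunE !in_itv/= ltr_norml => /andP[_ h1] /andP[h2 _] /andP[h3 h4].
  by apply/andP; split; lra.
move=> j; rewrite /lo /hi ffunE /=.
by have:= qlP j; have:= qhP j; rewrite !in_itv/= => /andP[-> _] /andP[_ ->].
Qed.

Lemma continuous_measurable3 f :
  continuous f -> measurable_fun setT (fun p : R3 => f (vec3 p) : mR).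
Proof.
move=> /continuousP cf; apply: (measurability _ (RGenOpens.measurableE R)).
move=> _ [_ [x [y ->] <-]]; rewrite setTI.
exact: (open_measurable3 (cf _ (interval_open _ _))).
Qed.

Lemma continuous_coord3 (j : 'I_3) : continuous (fun x : E => x 0 j).
Proof. by move=> x; exact: coord_continuous. Qed.

Lemma dotE (x y : E) :
  dot x y = x 0 0 * y 0 0 + x 0 1 * y 0 1 + x 0 2%:R * y 0 2%:R.
Proof.
rewrite /dot !big_ord_recl big_ord0 addr0 addrA.
by congr (_ + x 0 _ * y 0 _ + x 0 _ * y 0 _); exact/val_inj.
Qed.

Lemma continuous_enorm : continuous (@enorm R).
Proof.
move=> x; apply: continuous_comp; last exact: sqrt_continuous.
rewrite (_ : (fun y : E => dot y y) =
    fun y : E => y 0 0 * y 0 0 + y 0 1 * y 0 1 + y 0 2%:R * y 0 2%:R).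
  by do ?[apply: continuousD|apply: continuousM|exact: continuous_coord3].
by apply/funext => y; rewrite dotE.
Qed.

Lemma normr_coord_enorm (x : E) j : `|x 0 j| <= enorm x.
Proof.
rewrite -sqrtr_sqr ler_sqrt; last by apply: sumr_ge0 => i _; rewrite -expr2 sqr_ge0.
rewrite /dot (bigD1 j)//= expr2 lerDl; apply: sumr_ge0 => i _.
by rewrite -expr2 sqr_ge0.
Qed.

Lemma coord_lt_nat (x : E) : exists n : nat, forall j, `|x 0 j| < n%:R.
Proof.
exists (Num.truncn (enorm x)).+1 => j.
exact: le_lt_trans (normr_coord_enorm x j) (truncnS_gt _).
Qed.

Lemma measurable_ball3 (r : R) : measurable [set p : R3 | enorm (vec3 p) <= r].
Proof.
have := continuous_measurable3 continuous_enorm measurableT (measurable_itv `]-oo, r]).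
by rewrite setTI; congr measurable; apply/seteqP; split => p /=; rewrite in_itv.
Qed.

Lemma lebesgue3_box a b : (lebesgue3 (box a b) < +oo)%E.
Proof.
rewrite (_ : box a b = (`]a 0, b 0[ `*` `]a 1, b 1[) `*` `]a 2%:R, b 2%:R[).
  have fin (x y : R) : exists r, lebesgue_measure (`]x, y[%classic : set mR) = r%:E.
    by rewrite lebesgue_measure_itv/=; case: ifP => _; eexists; rewrite -?EFinB.
  have [r0 e0] := fin (a 0) (b 0); have [r1 e1] := fin (a 1) (b 1).
  have [r2 e2] := fin (a 2%:R) (b 2%:R).
  have m0 (x y : R) : measurable (`]x, y[%classic : set mR) by exact: measurable_itv.
  rewrite [X in (X < _)%E](_ : _ = (r0%:E * r1%:E * r2%:E)%E) -?EFinM ?ltry//.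
  rewrite !EFinM -e0 -e1 -e2 -product_measure1E//.
  exact: product_measure1E (measurableX _ _) _.
apply/seteqP; split => p /=.
  by move=> H; have:= H 0; have:= H 1; have:= H 2%:R;
    rewrite vec3E0 vec3E1 vec3E2 !in_itv/=.
by rewrite !in_itv/= => -[[h0 h1] h2]; elim/ord3P; rewrite ?vec3E0 ?vec3E1 ?vec3E2.
Qed.

Lemma lebesgue3_ball (r : R) :
  (lebesgue3 [set p | (enorm (vec3 p) <= r)%R] < +oo)%E.
Proof.
apply: le_lt_trans (lebesgue3_box (fun=> - (`|r| + 1)) (fun=> `|r| + 1)).
apply: le_measure; rewrite ?inE; [exact: measurable_ball3|exact: measurable_box|].
move=> p /= pr j; rewrite -ltr_norml (le_lt_trans (normr_coord_enorm _ _))//.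
by rewrite (le_lt_trans pr)// (le_lt_trans (ler_norm _))// ltrDl.
Qed.

Lemma continuous_bounded_ball f (r : R) : continuous f ->
  exists M, 0 <= M /\ forall x, enorm x <= r -> `|f x| <= M.
Proof.
move=> cf; pose K := [set x : E | enorm x <= r].
have cK : compact K.
  apply: bounded_closed_compact.
    exists `|r|; split; first exact: num_real.
    move=> M rM x /= xr; rewrite /Num.norm /= mx_normrE.
    apply/bigmax_leP; split; first by rewrite ltW// (le_lt_trans _ rM).
    move=> [i j] _ /=; rewrite ord1 (le_trans (normr_coord_enorm _ _))//.
    by rewrite (le_trans xr)// (le_trans (ler_norm _))// ltW.
  rewrite (_ : K = @enorm R @^-1` `]-oo, r]); last first.
    by apply/seteqP; split => x /=; rewrite in_itv.
  by apply: closed_comp => [x _|]; [exact: continuous_enorm|exact: interval_closed].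
have /compact_bounded[M [_ HM]] : compact (f @` K).
  by apply: continuous_compact => //; exact: continuous_subspaceT.
exists (`|M| + 1); split; first by rewrite addr_ge0.
move=> x xr; apply: (HM (`|M| + 1)); first by rewrite (le_lt_trans (ler_norm _))// ltrDl.
by exists x.
Qed.

End Boxes.

(** * Locally integrable and smooth functions *)

Section Integrability.
Variable R : realType.
Local Notation E := 'rV[R]_3.
Local Notation mR := (measurableTypeR R).
Local Notation R3 := (mR * mR * mR)%type.
Local Notation mu := (@lebesgue3 R).
Implicit Types (h f : E -> R).

Definition locint h := forall r : R,
  mu.-integrable [set p : R3 | enorm (vec3 p) <= r]
    (fun p => (h (vec3 p))%:E).

Lemma locint_measurable h : locint h ->
  measurable_fun setT (fun p : R3 => (h (vec3 p))%:E).
Proof.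
move=> ih; rewrite (_ : setT = \bigcup_n [set p : R3 | enorm (vec3 p) <= n%:R]).
  apply/measurable_fun_bigcup => n; first exact: measurable_ball3.
  exact: measurable_int (ih n%:R).
apply/seteqP; split => // p _; exists (Num.truncn (enorm (vec3 p))).+1 => //=.
by rewrite ltW// truncnS_gt.
Qed.

Lemma locint_cst (c : R) : locint (fun=> c).
Proof.
move=> r; apply: measurable_bounded_integrable.
- exact: measurable_ball3.
- exact: lebesgue3_ball.
- exact: measurable_cst.
- exact: bounded_cst.
Qed.

Lemma locintM h f : locint h -> continuous f -> locint (fun x => h x * f x).
Proof.
move=> ih cf r; rewrite (_ : (fun p => _) =
  ((fun p : R3 => (h (vec3 p))%:E) \* (EFin \o (fun p => f (vec3 p))))%E)//.
apply: integrableMl => //; first exact: measurable_ball3.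
  apply: measurable_funTS; exact: continuous_measurable3.
have [M [M0 HM]] := continuous_bounded_ball r cf.
exists M; split; first exact: num_real.
by move=> N MN p /= pr; rewrite (le_trans (HM _ pr))// ltW.
Qed.

Lemma locintD h f : locint h -> locint f -> locint (fun x => h x + f x).
Proof.
move=> ih jf r.
exact: (@integrableD _ _ _ mu _ (measurable_ball3 r) _ _ (ih r) (jf r)).
Qed.

Lemma locintN h : locint h -> locint (fun x => - h x).
Proof.
by move=> ih r; exact: (@integrableN _ _ _ mu _ _ (ih r)).
Qed.

Lemma locintB h f : locint h -> locint f -> locint (fun x => h x - f x).
Proof. by move=> ih jf; exact: locintD ih (locintN jf). Qed.

Lemma locint_supp h (r : R) : locint h ->
  (forall x, r < enorm x -> h x = 0) ->
  mu.-integrable setT (fun p : R3 => (h (vec3 p))%:E).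
Proof.
move=> ih h0; rewrite (_ : (fun p => _) =
  (fun p : R3 => (h (vec3 p))%:E) \_ [set p : R3 | enorm (vec3 p) <= r]).
  exact: ((integrable_mkcond _ (measurable_ball3 r)).1 (ih r)).
apply/funext => p; rewrite patchE; case: ifPn => //.
by rewrite notin_setE /= => /negP; rewrite -ltNge => /h0 ->.
Qed.

End Integrability.

Section Smooth.
Variable R : realType.
Local Notation E := 'rV[R]_3.
Local Notation C := R[i].
Implicit Types (phi psi : E -> C) (c : C).
Local Notation Re := complex.Re.
Local Notation Im := complex.Im.

Definition cdiff phi (x : E) :=
  differentiable (fun y => Re (phi y)) x /\ differentiable (fun y => Im (phi y)) x.

(** Smoothness quantifies over iterated derivatives.  This principle replaces an
    induction on their order by one invariant, stable under one derivative. *)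
Lemma smooth_coind (P : (E -> C) -> Prop) phi :
  (forall psi x, P psi -> cdiff psi x) ->
  (forall psi j, P psi -> P (partial j psi)) ->
  P phi -> smooth phi.
Proof.
move=> Pd Pp Pphi s x; apply: (Pd (partials s phi)).
by elim: s => //= j s; exact: Pp.
Qed.

Lemma smooth_cdiff phi x : smooth phi -> cdiff phi x.
Proof. by move=> /(_ [::]); exact. Qed.

Lemma smooth_partial j phi : smooth phi -> smooth (partial j phi).
Proof. by move=> sphi s; have := sphi (rcons s j); rewrite /partials foldr_rcons. Qed.

Lemma cdiff_derivable phi x v : cdiff phi x ->
  derivable (fun y => Re (phi y)) x v /\ derivable (fun y => Im (phi y)) x v.
Proof. by move=> [? ?]; split; exact: diff_derivable. Qed.

Lemma cdiffD phi psi x : cdiff phi x -> cdiff psi x ->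
  cdiff (fun y => phi y + psi y) x.
Proof.
move=> [? ?] [? ?]; split; [under eq_fun do rewrite ReD|under eq_fun do rewrite ImD];
exact: differentiableD.
Qed.

Lemma derive_add (f g : E -> R) x v : derivable f x v -> derivable g x v ->
  'D_v (fun y => f y + g y) x = 'D_v f x + 'D_v g x.
Proof. exact: deriveD. Qed.

Lemma derive_sub (f g : E -> R) x v : derivable f x v -> derivable g x v ->
  'D_v (fun y => f y - g y) x = 'D_v f x - 'D_v g x.
Proof. exact: deriveB. Qed.

Lemma derive_mul (f g : E -> R) x v : derivable f x v -> derivable g x v ->
  'D_v (fun y => f y * g y) x = f x * 'D_v g x + g x * 'D_v f x.
Proof. exact: deriveM. Qed.

Lemma partialD j phi psi : (forall x, cdiff phi x) -> (forall x, cdiff psi x) ->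
  partial j (fun y => phi y + psi y) = fun y => partial j phi y + partial j psi y.
Proof.
move=> dphi dpsi; apply/funext => x.
have [dR1 dI1] := cdiff_derivable (delta_mx 0 j) (dphi x).
have [dR2 dI2] := cdiff_derivable (delta_mx 0 j) (dpsi x).
have eR : (fun y => Re (phi y + psi y)) = fun y => Re (phi y) + Re (psi y).
  by apply/funext => y; exact: ReD.
have eI : (fun y => Im (phi y + psi y)) = fun y => Im (phi y) + Im (psi y).
  by apply/funext => y; exact: ImD.
by rewrite /partial eR eI derive_add// derive_add.
Qed.

Lemma smoothD phi psi : smooth phi -> smooth psi ->
  smooth (fun x => phi x + psi x).
Proof.
move=> sphi spsi; apply: (@smooth_coind (fun f =>
  exists f1 f2, [/\ smooth f1, smooth f2 & f = fun x => f1 x + f2 x])).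
- by move=> _ x [f1 [f2 [s1 s2 ->]]]; apply: cdiffD; exact: smooth_cdiff.
- move=> _ j [f1 [f2 [s1 s2 ->]]]; rewrite partialD; [|by move=> ?; exact: smooth_cdiff..].
  by exists (partial j f1), (partial j f2); split => //; exact: smooth_partial.
- by exists phi, psi.
Qed.

Lemma cdiff_coordM c i phi x : cdiff phi x ->
  cdiff (fun y => c * (y 0 i)%:C * phi y) x.
Proof.
move=> [dR dI]; split.
  under eq_fun do rewrite !(ReM, ImM)/= !mulr0 subr0 add0r.
  by apply: differentiableB; apply: differentiableM => //;
    apply: differentiableM => //; exact: differentiable_coord.
under eq_fun do rewrite !(ReM, ImM)/= !mulr0 subr0 add0r.
by apply: differentiableD; apply: differentiableM => //;
  apply: differentiableM => //; exact: differentiable_coord.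
Qed.

Lemma derive_coord i (x v : E) : 'D_v (fun y : E => y 0 i) x = v 0 i.
Proof.
have := @derive_mx R E 1 3 id x v (@derivable_id _ _ _ _).
by rewrite derive_id => /(congr1 (fun M : E => M 0 i)) ->; rewrite mxE.
Qed.

Lemma derive_scale (k : R) (f : E -> R) x v : derivable f x v ->
  'D_v (fun y => k * f y) x = k * 'D_v f x.
Proof. exact: deriveZ. Qed.

Lemma derivable_coord i (x v : E) : derivable (fun y : E => y 0 i) x v.
Proof. exact/diff_derivable/differentiable_coord. Qed.

Lemma derivable_scale (k : R) (f : E -> R) x v : derivable f x v ->
  derivable (fun y => k * f y) x v.
Proof. exact: derivableZ. Qed.

Lemma derivable_mul (f g : E -> R) x v : derivable f x v -> derivable g x v ->
  derivable (fun y => f y * g y) x v.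
Proof. exact: derivableM. Qed.

Lemma derive_coordM (k : R) i (f : E -> R) x v : derivable f x v ->
  'D_v (fun y : E => k * y 0 i * f y) x = k * x 0 i * 'D_v f x + k * v 0 i * f x.
Proof.
move=> df; have dk : derivable (fun y : E => k * y 0 i) x v.
  by apply: derivable_scale; exact: derivable_coord.
rewrite (derive_mul dk df) derive_scale; last exact: derivable_coord.
by rewrite derive_coord [f x * _]mulrC.
Qed.

Lemma derivable_coordM (k : R) i (f : E -> R) x v : derivable f x v ->
  derivable (fun y : E => k * y 0 i * f y) x v.
Proof. by move=> df; apply: derivable_mul => //; apply/derivable_scale/derivable_coord. Qed.

Lemma smoothZ c phi : smooth phi -> smooth (fun x => c * phi x).
Proof.
move=> sphi; apply: (@smooth_coind (fun f =>
  exists2 f1, smooth f1 & f = fun x => c * f1 x)); last by exists phi.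
- move=> _ x [f1 s1 ->]; have [dR dI] := smooth_cdiff x s1; split.
    under eq_fun do rewrite ReM.
    by apply: differentiableB; apply: differentiableM.
  under eq_fun do rewrite ImM.
  by apply: differentiableD; apply: differentiableM.
- move=> _ j [f1 s1 ->]; exists (partial j f1); first exact: smooth_partial.
  apply/funext => x; have [dR dI] := cdiff_derivable (delta_mx 0 j) (smooth_cdiff x s1).
  have eR : (fun y => Re (c * f1 y)) = fun y => Re c * Re (f1 y) - Im c * Im (f1 y).
    by apply/funext => y; exact: ReM.
  have eI : (fun y => Im (c * f1 y)) = fun y => Re c * Im (f1 y) + Im c * Re (f1 y).
    by apply/funext => y; exact: ImM.
  rewrite /partial eR eI derive_sub ?derive_add; [|exact: derivable_scale..].
  by rewrite !derive_scale//; apply: complexP; rewrite ?(ReM, ImM).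
Qed.

Lemma partial_coordM j c i phi : smooth phi ->
  partial j (fun y => c * (y 0 i)%:C * phi y) =
  fun y => c * (y 0 i)%:C * partial j phi y + c * (j == i)%:R * phi y.
Proof.
move=> sphi; apply/funext => x.
have [dR dI] := cdiff_derivable (delta_mx 0 j) (smooth_cdiff x sphi).
have eR : (fun y : E => Re (c * (y 0 i)%:C * phi y)) =
    fun y => Re c * y 0 i * Re (phi y) - Im c * y 0 i * Im (phi y).
  by apply/funext => y; rewrite !(ReM, ImM)/= !mulr0 subr0 add0r.
have eI : (fun y : E => Im (c * (y 0 i)%:C * phi y)) =
    fun y => Re c * y 0 i * Im (phi y) + Im c * y 0 i * Re (phi y).
  by apply/funext => y; rewrite !(ReM, ImM)/= !mulr0 subr0 add0r.
rewrite /partial eR eI derive_sub ?derive_add; [|exact: derivable_coordM..].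
rewrite !derive_coordM// mxE eqxx [i == j]eq_sym/=.
have -> : (j == i)%:R = ((j == i)%:R : R)%:C by rewrite rmorph_nat.
apply: complexP; rewrite !(ReD, ImD, ReM, ImM)/=; ring.
Qed.

(** The derivative of c x_i f involves f again, so the invariant is the set
    of functions c x_i f1 + f2 with f1 and f2 smooth. *)
Lemma smooth_coordM c i phi : smooth phi ->
  smooth (fun y => c * (y 0 i)%:C * phi y).
Proof.
move=> sphi; apply: (@smooth_coind (fun f => exists f1 f2,
  [/\ smooth f1, smooth f2 & f = fun y => c * (y 0 i)%:C * f1 y + f2 y])).
- move=> _ x [f1 [f2 [s1 s2 ->]]]; apply: cdiffD; last exact: smooth_cdiff.
  by apply: cdiff_coordM; exact: smooth_cdiff.
- move=> _ j [f1 [f2 [s1 s2 ->]]].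
  rewrite partialD; last by move=> ?; exact: smooth_cdiff.
    exists (partial j f1), (fun y => c * (j == i)%:R * f1 y + partial j f2 y).
    split; [exact: smooth_partial| |].
      by apply: smoothD; [exact: smoothZ|exact: smooth_partial].
    by rewrite partial_coordM//; apply/funext => y; rewrite addrA.
  by move=> ?; apply: cdiff_coordM; exact: smooth_cdiff.
- exists phi, (fun y => 0 * phi y); split => //; first exact: smoothZ.
  by apply/funext => y; rewrite mul0r addr0.
Qed.

Lemma test_function_coordM c i phi : test_function phi ->
  test_function (fun y => c * (y 0 i)%:C * phi y).
Proof.
move=> [sphi [r phi0]]; split; first exact: smooth_coordM.
by exists r => x /phi0 ->; rewrite mulr0.
Qed.

Lemma test_function_continuous phi : test_function phi ->
  continuous (fun x => Re (phi x)) /\ continuous (fun x => Im (phi x)).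
Proof.
move=> [sphi _]; split=> x; have [dR dI] := smooth_cdiff x sphi;
exact: differentiable_continuous.
Qed.

End Smooth.

(** * Derivatives of the Fourier transform of a test function *)

Section Trig.
Variable R : realType.

Lemma is_derive_wave (al be a b t : R) :
  is_derive t 1 (fun s => cos (al * s + be) * a + sin (al * s + be) * b)
    (cos (al * t + be) * (al * b) + sin (al * t + be) * - (al * a)).
Proof.
apply: is_derive_eq; rewrite /GRing.scale /=; ring.
Qed.

Lemma wave_le (th a b : R) : `|cos th * a + sin th * b| <= `|a| + `|b|.
Proof.
rewrite (le_trans (ler_normD _ _))// !normrM lerD// ler_piMl// ler_norml.
  by rewrite cos_geN1 cos_le1.
by rewrite sin_geN1 sin_le1.
Qed.

End Trig.

Section Fourier.
Variable R : realType.
Local Notation E := 'rV[R]_3.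
Local Notation C := R[i].
Local Notation mR := (measurableTypeR R).
Local Notation R3 := (mR * mR * mR)%type.
Local Notation mu := (@lebesgue3 R).
Local Notation Re := complex.Re.
Local Notation Im := complex.Im.
Implicit Types (phi psi : E -> C) (a b f : E -> R).

(** The real and the imaginary part of the integrand of the Fourier transform
    both have this form, for suitable a and b. *)
Definition wave a b (xi x : E) : R :=
  cos (2 * pi * dot x xi) * a x + sin (2 * pi * dot x xi) * b x.

Lemma fourierE phi xi : fourier phi xi =
  Rintegral mu setT (fun p => wave (fun x => Re (phi x)) (fun x => Im (phi x)) xi (vec3 p)) +i*
  Rintegral mu setT (fun p => wave (fun x => Im (phi x)) (fun x => - Re (phi x)) xi (vec3 p)).
Proof.
rewrite /fourier /integral3 /wave; congr (_ +i* _); apply: eq_Rintegral => p _.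
  by rewrite ReM /= mulNr opprK.
by rewrite ImM /= mulNr mulrN.
Qed.

Lemma dot_shift (x xi : E) j t :
  dot x (t *: delta_mx 0 j + xi) = x 0 j * t + dot x xi.
Proof.
rewrite /dot (bigD1 j)//= [X in _ = _ + X](bigD1 j)//= addrA; congr (_ + _).
  by rewrite !mxE !eqxx/= mulr1 mulrDr.
by apply: eq_bigr => i /negPf ij; rewrite !mxE ij andbF mulr0 add0r.
Qed.

(** Fixes the type of the point to row vectors, which lets the arithmetic rules
    for continuity at a point apply. *)
Lemma continuous3P f : (forall x : E, {for x, continuous f}) -> continuous f.
Proof. by []. Qed.

Lemma continuous_dot (xi : E) : continuous (fun x : E => dot x xi).
Proof.
rewrite (_ : (fun x : E => dot x xi) =
    fun x : E => x 0 0 * xi 0 0 + x 0 1 * xi 0 1 + x 0 2%:R * xi 0 2%:R).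
  have cj k (x : E) : {for x, continuous (fun x : E => x 0 k * xi 0 k)}.
    apply: continuousM; first exact: continuous_coord3.
    exact: cst_continuous.
  by move=> x; exact: (continuousD (continuousD (cj 0 x) (cj 1 x)) (cj 2%:R x)).
by apply/funext => x; rewrite dotE.
Qed.

Lemma continuous_wave a b xi : continuous a -> continuous b ->
  continuous (wave a b xi).
Proof.
move=> ca cb x.
have cth : {for x, continuous (fun x : E => 2 * pi * dot x xi)}.
  by apply: continuousM; [exact: cst_continuous|exact: continuous_dot].
suff : {for x, continuous (fun y => cos (2 * pi * dot y xi) * a y +
                             sin (2 * pi * dot y xi) * b y)} by [].
apply: continuousD; apply: continuousM => //; [|exact: ca| |exact: cb].
  by apply: continuous_comp; [exact: cth|exact: continuous_cos].
by apply: continuous_comp; [exact: cth|exact: continuous_sin].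
Qed.

Lemma integrable_compact f (r : R) : continuous f ->
  (forall x : E, r < enorm x -> f x = 0) ->
  mu.-integrable setT (fun p : R3 => (f (vec3 p))%:E).
Proof.
move=> cf; apply: locint_supp.
have -> : f = fun x => 1 * f x by apply/funext => x; rewrite mul1r.
by apply: locintM => //; exact: locint_cst.
Qed.

(** Along a coordinate line the phase is affine, so the integrand is a sinusoid
    whose derivative is bounded, uniformly in the parameter, by the sum of the
    absolute values of its amplitudes. *)
Lemma derive_wave_integral a b (r : R) j xi :
  continuous a -> continuous b ->
  (forall x, r < enorm x -> a x = 0) -> (forall x, r < enorm x -> b x = 0) ->
  'D_(delta_mx 0 j) (fun z => Rintegral mu setT (fun p => wave a b z (vec3 p))) xi
  = Rintegral mu setT (fun p =>
      wave (fun x => 2 * pi * x 0 j * b x) (fun x => - (2 * pi * x 0 j * a x)) xi (vec3 p)).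
Proof.
move=> ca cb a0 b0.
pose f (t : R) (p : R3) := wave a b (t *: delta_mx 0 j + xi) (vec3 p).
pose G (p : R3) := `|2 * pi * vec3 p 0 j * b (vec3 p)| +
  `|- (2 * pi * vec3 p 0 j * a (vec3 p))|.
have df (t : R) (p : R3) : is_derive t (1 : R) (f^~ p)
  (wave (fun x => 2 * pi * x 0 j * b x) (fun x => - (2 * pi * x 0 j * a x))
     (t *: delta_mx 0 j + xi) (vec3 p)).
  have := is_derive_wave (2 * pi * vec3 p 0 j) (2 * pi * dot (vec3 p) xi)
    (a (vec3 p)) (b (vec3 p)) t.
  rewrite /f /wave.
  have th s : 2 * pi * dot (vec3 p) (s *: delta_mx 0 j + xi) =
      2 * pi * vec3 p 0 j * s + 2 * pi * dot (vec3 p) xi.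
    by rewrite dot_shift mulrDr mulrA.
  by under eq_fun do rewrite -th; rewrite -th.
have ccoord c (g : E -> R) (x : E) : continuous g ->
    {for x, continuous (fun x : E => c * x 0 j * g x)}.
  move=> cg; apply: continuousM; last exact: cg.
  by apply: continuousM; [exact: cst_continuous|exact: continuous_coord3].
have d1f : partial1of2 f = fun (t : R) (p : R3) =>
    wave (fun x => 2 * pi * x 0 j * b x) (fun x => - (2 * pi * x 0 j * a x))
     (t *: delta_mx 0 j + xi) (vec3 p).
  by apply/funext => t; apply/funext => p; rewrite partial1of2E; exact: derive_val.
have cvf : h^-1 *: (Rintegral mu setT (f (h + 0)) - Rintegral mu setT (f 0))
    @[h --> 0^'] --> Rintegral mu setT (partial1of2 f 0).
  apply: (@cvg_differentiation_under_integral R _ R3 mu f setT measurableT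
    0 (-1) 1 _ _ _ G).
  - by rewrite /= in_itv/= oppr_lt0 ltr01.
  - move=> t _; apply: (@integrable_compact _ r).
      exact: continuous_wave.
    by move=> x rx; rewrite /wave a0// b0// !mulr0 addr0.
  - by move=> t p _ _; case: (df t p).
  - by move=> p; rewrite /G addr_ge0.
  - apply: (@integrable_compact (fun x => `|2 * pi * x 0 j * b x| +
      `|- (2 * pi * x 0 j * a x)|) r).
      apply: continuous3P => x; apply: continuousD.
        by apply: continuous_comp; [exact: ccoord|exact: norm_continuous].
      apply: continuous_comp; last exact: norm_continuous.
      by apply: continuousN; exact: ccoord.
    by move=> x rx; rewrite a0// b0// !mulr0 oppr0 normr0 addr0.
  - by move=> t p _ _; rewrite d1f /G; exact: wave_le.
apply/cvg_lim => //.
have -> : Rintegral mu setT (fun p =>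
      wave (fun x => 2 * pi * x 0 j * b x) (fun x => - (2 * pi * x 0 j * a x)) xi (vec3 p)) =
    Rintegral mu setT (partial1of2 f 0).
  by rewrite d1f; apply: eq_Rintegral => p _; rewrite scale0r add0r.
rewrite (_ : (fun h : R => h^-1 *: _) =
  fun h => h^-1 *: (Rintegral mu setT (f (h + 0)) - Rintegral mu setT (f 0)))//.
apply/funext => h; rewrite addr0 /=; congr (_ *: (_ - _)).
by apply: eq_Rintegral => p _; rewrite /f scale0r add0r.
Qed.

(** The phase 2 pi x . xi has derivative 2 pi x_j along the j-th axis.  With a
    and b the real and imaginary parts of phi, the amplitudes of the derivative
    are those of - 2 pi i x_j phi. *)
Lemma fourier_partial j phi : test_function phi ->
  partial j (fourier phi) =
  fourier (fun x => (0 -i* (2 * pi)) * (x 0 j)%:C * phi x).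
Proof.
move=> tphi; have [cR cI] := test_function_continuous tphi.
have [_ [r phi0]] := tphi.
have R0 x : r < enorm x -> Re (phi x) = 0 by move=> /phi0 ->.
have I0 x : r < enorm x -> Im (phi x) = 0 by move=> /phi0 ->.
apply/funext => xi; rewrite [RHS]fourierE /partial.
have eR : (fun z => Re (fourier phi z)) = fun z =>
   Rintegral mu setT (fun p => wave (fun x => Re (phi x)) (fun x => Im (phi x)) z (vec3 p)).
  by apply/funext => z; rewrite fourierE.
have eI : (fun z => Im (fourier phi z)) = fun z =>
   Rintegral mu setT (fun p => wave (fun x => Im (phi x)) (fun x => - Re (phi x)) z (vec3 p)).
  by apply/funext => z; rewrite fourierE.
rewrite eR eI (derive_wave_integral _ _ cR cI R0 I0).
rewrite (@derive_wave_integral _ _ r)//; last first.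
- by move=> x /R0 ->; rewrite oppr0.
- by apply: continuous3P => x; apply: continuousN; exact: cR.
congr (_ +i* _); apply: eq_Rintegral => p _; congr (_ * _ + _ * _);
  rewrite !(ReM, ImM)/=; ring.
Qed.

End Fourier.

(** * Smooth functions flat at the origin *)

Section Flat.
Variables (R : realType) (c : R).
Hypothesis c0 : 0 < c.
Implicit Types (p : {poly R}) (t : R).

(** With p = 1 this is the classical smooth function exp(- c / t) extended
    by 0.  The polynomial factor makes the family stable under derivation, and
    the free constant c makes it approach the indicator of t > 0. *)
Definition flat p t : R := if 0 < t then p.[t^-1] * expR (- (c / t)) else 0.

Lemma exprn_expRN_le n y : 0 < y -> y ^+ n.+1 * expR (- (c * y)) <= n.+1`!%:R / c ^+ n.+1.
Proof.
move=> y0; rewrite expRN -[leLHS]/(_ / _) ler_pdivrMr ?expR_gt0//.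
have cy0 : 0 <= c * y by rewrite mulr_ge0// ltW.
have f0 : 0 < n.+1`!%:R :> R by rewrite ltr0n fact_gt0.
have c1 : 0 < c ^+ n.+1 by rewrite exprn_gt0.
rewrite mulrAC ler_pdivlMr// -exprMn [y * c]mulrC -ler_pdivrMl//.
by apply: le_trans (expR_ge1Dxn n cy0); rewrite [leLHS]mulrC ?lerDr ?ler01.
Qed.

(** Exponential decay beats every power of 1 / t.  Applied to 'X * p, this bound
    makes the difference quotient of flat p at the origin tend to 0. *)
Lemma flat_le p : exists K, forall t, `|flat p t| <= K * `|t|.
Proof.
suff [K HK] : exists K, forall y, 0 < y -> `|p.[y]| * y * expR (- (c * y)) <= K.
  have K0 : 0 <= K.
    by apply: le_trans (HK 1 ltr01); rewrite !mulr_ge0// expR_ge0.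
  exists K => t; rewrite /flat; case: ifPn => [t0|_]; last by rewrite normr0 mulr_ge0.
  rewrite normrM (gtr0_norm (expR_gt0 _)) (gtr0_norm t0) -ler_pdivrMr//.
  by rewrite mulrAC HK// invr_gt0.
(* An extra power of y is needed to absorb the factor 'X when p grows. *)
suff : forall n, exists K, forall y, 0 < y ->
    `|p.[y]| * y ^+ n.+1 * expR (- (c * y)) <= K by move=> /(_ 0).
elim/poly_ind: p => [|p a IH] n.
  by exists 0 => y _; rewrite horner0 normr0 !mul0r.
have [K HK] := IH n.+1.
exists (K + `|a| * (n.+1`!%:R / c ^+ n.+1)) => y y0.
rewrite !hornerE (le_trans (y := (`|p.[y]| * y + `|a|) * y ^+ n.+1 * expR (- (c * y))))//.
  rewrite !ler_pM2r ?expR_gt0 ?exprn_gt0// (le_trans (ler_normD _ _))//.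
  by rewrite normrM (gtr0_norm y0).
rewrite 2!mulrDl lerD//; last first.
  by rewrite -[leLHS]mulrA -[leRHS]mulrA; apply: ler_wpM2l => //; exact: exprn_expRN_le.
by rewrite -[_ * y * _]mulrA -exprS HK.
Qed.

(** The factor 'X^2 comes from differentiating 1 / t: the chain rule multiplies
    both the derivative of p and that of the exponential by - 1 / t^2.  At the
    origin flat_le makes the derivative from the right vanish. *)
Lemma is_derive_flat p t :
  is_derive t 1 (flat p) (flat ('X^2 * (c *: p - p^`())) t).
Proof.
have [t0|t0|->] := ltgtP t 0.
- rewrite [X in is_derive _ _ _ X](_ : _ = 0); last by rewrite /flat ltNge ltW.
  apply: (@near_eq_is_derive _ _ _ (cst 0)).
  near=> s; rewrite /flat /= ltNge ltW//; near: s.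
  exact: lt_nbhsl.
- rewrite [X in is_derive _ _ _ X](_ : _ =
      ('X^2 * (c *: p - p^`())).[t^-1] * expR (- (c / t))); last by rewrite /flat t0.
  apply: (@near_eq_is_derive _ _ _ (fun s : R => p.[s^-1] * expR (- (c / s)))).
    by near=> s; rewrite /flat ifT//; near: s; exact: lt_nbhsr.
  have tN0 : t != 0 by rewrite gt_eqF.
  have dV : is_derive t 1 (fun s : R => s^-1) (- t ^- 2).
    have := @is_deriveV R id t 1 1 tN0 _; rewrite /GRing.scale /= mulr1; apply.
  have dp : is_derive t 1 (fun s : R => p.[s^-1]) (p^`().[t^-1] * - t ^- 2).
    exact: (@is_derive1_comp _ (horner p) (fun s => s^-1)).
  have de : is_derive t 1 (fun s : R => expR (- (c / s)))
      (expR (- (c / t)) * (- (c * - t ^- 2))).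
    have dN := is_deriveN (is_deriveZ c dV).
    exact: (@is_derive1_comp _ expR _ _ _ _ (is_derive_expR _) dN).
  apply: is_derive_eq; rewrite /GRing.scale/=.
  rewrite hornerM hornerXn hornerD hornerN hornerZ exprVn; ring.
- have [K HK] := flat_le ('X * p).
  rewrite [X in is_derive _ _ _ X](_ : _ = 0); last by rewrite /flat ltxx.
  have lim0 : h^-1 *: ((flat p \o shift 0) (h *: (1 : R)) - flat p 0) @[h --> 0^'] --> (0 : R).
    have eqf (h : R) :
        h^-1 *: ((flat p \o shift 0) (h *: (1 : R)) - flat p 0) = flat ('X * p) h.
      rewrite /= addr0 scaler1 /flat ltxx subr0; case: ifP => h0; last by rewrite scaler0.
      by rewrite hornerM hornerX -mulrA.
    under eq_fun do rewrite eqf.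
    apply/cvgrPdist_le => e e0; near=> h; rewrite sub0r normrN (le_trans (HK h))//.
    have K1 : 0 < `|K| + 1 by rewrite ltr_wpDl.
    rewrite (le_trans (y := (`|K| + 1) * `|h|))//.
      by rewrite ler_wpM2r// (le_trans (ler_norm _))// lerDl.
    rewrite mulrC -ler_pdivlMr//; near: h; apply: dnbhs0_le.
    by rewrite divr_gt0.
  by apply: DeriveDef; [apply/cvg_ex; exists 0|exact/cvg_lim].
Unshelve. all: by end_near. Qed.

End Flat.

Section FlatAlgebra.
Variables (R : realType) (c : R).
Hypothesis c0 : 0 < c.
Local Notation E := 'rV[R]_3.

(** An algebra rich enough to contain bump functions supported in boxes, and
    stable under partial derivatives, so that all its elements are smooth. *)
Inductive flat_algebra : (E -> R) -> Prop :=
| FlatCoord p s a (j : 'I_3) : flat_algebra (fun x => flat c p (s * x 0 j + a))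
| FlatAdd f g : flat_algebra f -> flat_algebra g -> flat_algebra (fun x => f x + g x)
| FlatMul f g : flat_algebra f -> flat_algebra g -> flat_algebra (fun x => f x * g x).

Lemma flatZ k p t : flat c (k *: p) t = k * flat c p t.
Proof. by rewrite /flat; case: ifP; rewrite ?mulr0// hornerZ mulrA. Qed.

Lemma derive_line (f : E -> R) (x v : E) :
  'D_v f x = 'D_1 (fun t : R => f (t *: v + x)) 0.
Proof.
rewrite /derive.
have -> // : (fun h : R => h^-1 *: ((f \o shift x) (h *: v) - f x)) =
  fun h => h^-1 *:
    (((fun t : R => f (t *: v + x)) \o shift 0) (h *: (1 : R)) - f (0 *: v + x)).
by apply/funext => h /=; rewrite scaler1 addr0 scale0r add0r.
Qed.

Lemma derive_flat_coord p s a (j : 'I_3) (x v : E) :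
  'D_v (fun x : E => flat c p (s * x 0 j + a)) x =
  flat c ((s * v 0 j) *: ('X^2 * (c *: p - p^`()))) (s * x 0 j + a).
Proof.
pose g (t : R) := (s * v 0 j) * t + (s * x 0 j + a).
have eg : (fun t : R => flat c p (s * (t *: v + x) 0 j + a)) = flat c p \o g.
  by apply/funext => t; rewrite /g /= !mxE; congr (flat c p _); ring.
have dg : is_derive (0 : R) (1 : R) g (s * v 0 j).
  by apply: is_derive_eq; rewrite addr0 /GRing.scale/= mulr1.
have [_] := @is_derive1_comp _ (flat c p) g 0 _ _ (is_derive_flat c0 p _) dg.
rewrite derive_line flatZ -eg /g mulr0 add0r => dD.
rewrite [RHS]mulrC -dD //.
Qed.

Lemma flat_algebra_differentiable f x : flat_algebra f -> differentiable f x.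
Proof.
elim=> [p s a j|g h _ dg _ dh|g h _ dg _ dh].
- apply: (@differentiable_comp _ _ _ _ (fun x : E => s * x 0 j + a) (flat c p)).
    apply: differentiableD => //; apply: differentiableM => //.
    exact: differentiable_coord.
  by apply/derivable1_diffP; case: (is_derive_flat c0 p (s * x 0 j + a)).
- exact: differentiableD.
- exact: differentiableM.
Qed.

Lemma flat_algebra_derive f v : flat_algebra f -> flat_algebra ('D_v f).
Proof.
have der (g : E -> R) x : flat_algebra g -> derivable g x v.
  by move=> /(flat_algebra_differentiable x); exact: diff_derivable.
elim=> [p s a j|g h fg dg fh dh|g h fg dg fh dh].
- rewrite (_ : 'D_v _ = fun x : E =>
      flat c ((s * v 0 j) *: ('X^2 * (c *: p - p^`()))) (s * x 0 j + a)).
    exact: FlatCoord.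
  by apply/funext => x; exact: derive_flat_coord.
- rewrite (_ : 'D_v _ = fun x => 'D_v g x + 'D_v h x); first exact: FlatAdd.
  by apply/funext => x; rewrite derive_add//; exact: der.
- rewrite (_ : 'D_v _ = fun x => g x * 'D_v h x + h x * 'D_v g x).
    by apply: FlatAdd; exact: FlatMul.
  by apply/funext => x; rewrite derive_mul//; exact: der.
Qed.

Lemma flat_algebra_smooth f : flat_algebra f -> smooth (fun x => (f x)%:C).
Proof.
move=> ff; apply: (@smooth_coind _ (fun phi =>
  exists2 g, flat_algebra g & phi = fun x => (g x)%:C)); last by exists f.
- move=> _ x [g fg ->]; split => /=; last exact: differentiable_cst.
  exact: flat_algebra_differentiable.
- move=> _ j [g fg ->]; exists ('D_(delta_mx 0 j) g).
    exact: flat_algebra_derive.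
  by apply/funext => x; rewrite /partial /= (derive_cst 0).
Qed.

End FlatAlgebra.

(** * The fundamental lemma of the calculus of variations *)

Section Bump.
Variable R : realType.
Local Notation E := 'rV[R]_3.
Local Notation mR := (measurableTypeR R).
Local Notation R3 := (mR * mR * mR)%type.
Local Notation mu := (@lebesgue3 R).
Implicit Types (a b : 'I_3 -> R) (c t : R) (x : E) (h : E -> R).

(** Tends, as c decreases to 0, to the indicator of a j < x j < b j.  The affine
    arguments are spelled out in the form produced by flat_algebra. *)
Definition edge c a b j x := flat c 1 (1 * x 0 j + - a j) * flat c 1 (-1 * x 0 j + b j).
Definition bump c a b x := edge c a b 0 x * edge c a b 1 x * edge c a b 2%:R x.

Lemma flat1_bounds c t : 0 < c -> 0 <= flat c 1 t <= 1.
Proof.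
move=> c0; rewrite /flat; case: ifP => t0; last by rewrite lexx ler01.
by rewrite hornerC mul1r expR_ge0 -expR0 ler_expR oppr_le0 divr_ge0// ltW.
Qed.

Lemma edge_bounds c a b j x : 0 < c -> 0 <= edge c a b j x <= 1.
Proof.
move=> c0; rewrite /edge; have /andP[l1 u1] := flat1_bounds (1 * x 0 j + - a j) c0.
have /andP[l2 u2] := flat1_bounds (-1 * x 0 j + b j) c0.
by rewrite mulr_ge0//= mulr_ile1.
Qed.

Lemma bump_bounds c a b x : 0 < c -> 0 <= bump c a b x <= 1.
Proof.
move=> c0; rewrite /bump; have /andP[l0 u0] := edge_bounds a b 0 x c0.
have /andP[l1 u1] := edge_bounds a b 1 x c0.
have /andP[l2 u2] := edge_bounds a b 2%:R x c0.
have l01 := mulr_ge0 l0 l1; rewrite mulr_ge0//=.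
by rewrite mulr_ile1// mulr_ile1.
Qed.

Lemma edge_out c a b j x : ~ (a j < x 0 j < b j) -> edge c a b j x = 0.
Proof.
move=> /negP; rewrite negb_and -!leNgt /edge /flat => /orP[xa|bx].
  by rewrite ifF ?mul0r// mul1r subr_gt0 ltNge xa.
by rewrite [X in _ * X]ifF ?mulr0// mulN1r addrC subr_gt0 ltNge bx.
Qed.

Lemma bump_out c a b (p : R3) : ~ box a b p -> bump c a b (vec3 p) = 0.
Proof.
move=> /existsNP[j]; rewrite /bump; elim/ord3P: j => /edge_out ->;
by rewrite ?(mul0r, mulr0).
Qed.

Lemma edge_cvg a b j x : a j < x 0 j < b j ->
  edge n.+1%:R^-1 a b j x @[n --> \oo] --> (1 : R).
Proof.
have fc t : 0 < t -> flat n.+1%:R^-1 1 t @[n --> \oo] --> (1 : R).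
  move=> t0; rewrite /flat; under eq_fun do rewrite t0 hornerC mul1r -mulNr.
  suff : expR (- n.+1%:R^-1 / t) @[n --> \oo] --> expR (- 0 / t).
    by rewrite oppr0 mul0r expR0.
  apply: continuous_cvg; first exact: continuous_expR.
  by apply: cvgM; [apply: cvgN; exact: cvg_harmonic|exact: cvg_cst].
move=> /andP[ax xb].
have t1 : 0 < 1 * x 0 j + - a j by rewrite mul1r subr_gt0.
have t2 : 0 < -1 * x 0 j + b j by rewrite mulN1r addrC subr_gt0.
have H := cvgM (fc _ t1) (fc _ t2); rewrite mulr1 in H; exact: H.
Qed.

Lemma bump_cvg a b (p : R3) : box a b p ->
  bump n.+1%:R^-1 a b (vec3 p) @[n --> \oo] --> (1 : R).
Proof.
move=> pab.
have H := cvgM (cvgM (edge_cvg (pab 0)) (edge_cvg (pab 1))) (edge_cvg (pab 2%:R)).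
rewrite !mulr1 in H; exact: H.
Qed.

Lemma enorm_le_sum x : enorm x <= `|x 0 0| + `|x 0 1| + `|x 0 2%:R|.
Proof.
have s0 : 0 <= `|x 0 0| + `|x 0 1| + `|x 0 2%:R| by rewrite !addr_ge0.
rewrite -[leRHS]ger0_norm// -sqrtr_sqr ler_sqrt ?sqr_ge0// dotE -!expr2.
rewrite -(real_normK (num_real (x 0 0))) -(real_normK (num_real (x 0 1))).
rewrite -(real_normK (num_real (x 0 2%:R))).
have := normr_ge0 (x 0 0); have := normr_ge0 (x 0 1); have := normr_ge0 (x 0 2%:R).
move: `|_| `|_| `|_| => u v w u0 v0 w0; nra.
Qed.

Lemma box_bounded a b : exists r, forall p, box a b p -> enorm (vec3 p) <= r.
Proof.
pose m j := `|a j| + `|b j|.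
exists (m 0 + m 1 + m 2%:R) => p pab; apply: le_trans (enorm_le_sum _) _.
have H j : `|vec3 p 0 j| <= m j.
  rewrite /m ler_norml; have /andP[ax xb] := pab j.
  have := ler_norm (b j); have := ler_norm (- a j); rewrite normrN.
  by have := normr_ge0 (a j); have := normr_ge0 (b j); move=> *; apply/andP; split; lra.
by rewrite !lerD.
Qed.

Lemma vec3_surj x : exists p : R3, vec3 p = x.
Proof.
exists (x 0 0, x 0 1, x 0 2%:R); apply/rowP => j; move: j.
by apply: ord3P; rewrite ?vec3E0 ?vec3E1 ?vec3E2.
Qed.

Lemma test_function_bump c a b : 0 < c ->
  test_function (fun x => (bump c a b x)%:C).
Proof.
move=> c0; split.
  by apply: (flat_algebra_smooth c0); rewrite /bump /edge; do ?constructor.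
have [r rP] := box_bounded a b; exists r => x; have [p <-] := vec3_surj x => rp.
by rewrite bump_out// => /rP; rewrite leNgt rp.
Qed.

Lemma locint_integrable_box h a b : locint h ->
  mu.-integrable (box a b) (fun p => (h (vec3 p))%:E).
Proof.
move=> ih; have [r rP] := box_bounded a b.
apply: integrableS (ih r); [exact: measurable_ball3|exact: measurable_box|].
by move=> p /rP.
Qed.

(** The bumps with c = 1 / (n + 1) converge to the indicator of the box and stay
    below it, so dominated convergence carries the hypothesis to the limit. *)
Lemma integral_box0 h a b : locint h ->
  (forall f, test_function (fun x => (f x)%:C) ->
     Rintegral mu setT (fun p => h (vec3 p) * f (vec3 p)) = 0) ->
  (\int[mu]_(p in box a b) (h (vec3 p))%:E = 0)%E.
Proof.
move=> ih H; pose c n : R := n.+1%:R^-1.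
have c0 n : 0 < c n by rewrite invr_gt0.
pose F n (p : R3) := (h (vec3 p) * bump (c n) a b (vec3 p))%:E.
have iF n : mu.-integrable setT (F n).
  have [_ [r r0]] := test_function_bump a b (c0 n).
  have [cb _] := test_function_continuous (test_function_bump a b (c0 n)).
  apply: (@locint_supp _ (fun x => h x * bump (c n) a b x) r).
    exact: (locintM ih cb).
  by move=> x /r0 /(congr1 (@complex.Re R)) /= ->; rewrite mulr0.
have F0 n : (\int[mu]_p F n p = 0)%E.
  have Fn := H _ (test_function_bump a b (c0 n)).
  rewrite -[LHS]fineK; first by congr EFin; exact: Fn.
  exact: integrable_fin_num (iF n).
pose G := (fun p : R3 => (h (vec3 p))%:E) \_ (box a b).
have iG : mu.-integrable setT G.
  exact: ((integrable_mkcond _ (measurable_box a b)).1 (locint_integrable_box a b ih)).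
have [] := @dominated_convergence _ R3 _ mu setT measurableT F G (abse \o G).
- by move=> n; exact: measurable_int (iF n).
- exact: measurable_int iG.
- apply: aeW => p _; rewrite /F /G patchE; case: ifPn => [|]; rewrite ?inE ?notin_setE => pab.
    apply: cvg_EFin; first exact: nearW.
    suff : h (vec3 p) * bump (c n) a b (vec3 p) @[n --> \oo] --> h (vec3 p) * 1.
      by rewrite mulr1.
    by apply: cvgM; [exact: cvg_cst|exact: bump_cvg].
  under eq_fun do rewrite bump_out// mulr0.
  exact: cvg_cst.
- exact: integrable_abse.
- apply: aeW => p n _; rewrite /F /G /= patchE.
  case: ifPn => [_|]; last by rewrite notin_setE => /bump_out ->; rewrite mulr0 normr0 abse0.
  rewrite lee_fin normrM ler_piMr// ger0_norm.
    by have /andP[] := bump_bounds a b (vec3 p) (c0 n).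
  by have /andP[] := bump_bounds a b (vec3 p) (c0 n).
move=> _ _ limG; rewrite integral_mkcond.
apply: (cvg_unique _ limG) => //.
by apply: cvg_near_cst; apply: nearW => n; exact: F0.
Qed.

Lemma setI_box a b a' b' : box a b `&` box a' b' =
  box (fun j => Num.max (a j) (a' j)) (fun j => Num.min (b j) (b' j)).
Proof.
apply/seteqP; split => [p [pab pab'] j|p pP].
  have /andP[? ?] := pab j; have /andP[? ?] := pab' j.
  by rewrite gt_max lt_min; apply/andP; split; exact/andP.
by split => j; have := pP j; rewrite gt_max lt_min => /andP[/andP[? ?] /andP[? ?]]; apply/andP.
Qed.

Definition boxes : set (set R3) := [set A | exists a b, A = box a b].

(** Bounded boxes suffice to generate, since a slab is the increasing union of
    its truncations. *)
Lemma measurable_boxes : @measurable _ R3 = <<s boxes >>.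
Proof.
apply/seteqP; split; last first.
  apply: smallest_sub; first exact: sigma_algebra_measurable.
  by move=> _ [a [b ->]]; exact: measurable_box.
pose T := g_sigma_algebraType boxes.
have mcoord (j : 'I_3) : measurable_fun setT (fun p : T => vec3 (p : R3) 0 j : mR).
  apply: (measurability _ (RGenOpens.measurableE R)).
  move=> _ [_ [s [t ->]] <-]; rewrite setTI.
  rewrite (_ : _ @^-1` _ = \bigcup_n box (fun i => if i == j then s else - n%:R)
      (fun i => if i == j then t else n%:R)).
    by apply: bigcup_measurable => n _; apply: sub_sigma_algebra; do 2 eexists.
  apply/seteqP; split => [p /=|p [n _ /(_ j)]]; rewrite ?eqxx /= in_itv//= => pst.
  have [N pN] := coord_lt_nat (vec3 p).
  by exists N => // i; case: eqP => [->//|_]; rewrite -ltr_norml.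
have mid : measurable_fun setT (id : T -> R3).
  rewrite (_ : id = fun p : T => (p.1.1, p.1.2, p.2)); last by apply/funext => -[[]].
  apply: measurable_fun_pair; first apply: measurable_fun_pair.
  - by have := mcoord 0; under eq_fun do rewrite vec3E0.
  - by have := mcoord 1; under eq_fun do rewrite vec3E1.
  - by have := mcoord 2%:R; under eq_fun do rewrite vec3E2.
by move=> A mA; have := mid measurableT A mA; rewrite setTI.
Qed.

(** Intersecting with a fixed box keeps the integrals finite, as the step for
    complements in the pi-lambda theorem requires. *)
Lemma integral_measurable0 h a b (A : set R3) : locint h ->
  (forall a b, (\int[mu]_(p in box a b) (h (vec3 p))%:E = 0)%E) ->
  measurable A -> (\int[mu]_(p in A `&` box a b) (h (vec3 p))%:E = 0)%E.
Proof.
move=> ih H; rewrite measurable_boxes => sA.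
have mQ := measurable_box a b; have iQ := locint_integrable_box a b ih.
move: A sA; apply: (dynkin_induction (T := R3) measurable_boxes).
- move=> _ _ [a1 [b1 ->]] [a2 [b2 ->]]; rewrite setI_box.
  by do 2 eexists.
- by rewrite setTI.
- by move=> _ [a1 [b1 ->]]; rewrite setI_box.
- move=> S mS S0; have := H a b.
  rewrite -[in X in X -> _](setTI (box a b)) -(setvU S) setIUl.
  rewrite integral_setU//=.
  - by rewrite S0 adde0.
  - by apply: measurableI => //; exact: measurableC.
  - exact: measurableI.
  - by rewrite -setIUl setvU setTI; exact: measurable_int iQ.
  - by apply/disj_setPS => p [[pS _] [nS _]]; exact: (pS nS).
- move=> F mF tF F0; rewrite setI_bigcupl integral_bigcup//.
  - by apply: eseries0 => n _ _; exact: F0.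
  - exact: trivIset_setIr.
  - by move=> n; exact: measurableI.
  - apply: integrableS iQ => //; last by move=> p [n _ []].
    by apply: bigcup_measurable => n _; exact: measurableI.
Qed.

(** Almost everywhere equality is obtained on each cube, where the function is
    integrable, and then on their countable union. *)
Lemma ae_zero_test h : locint h ->
  (forall f, test_function (fun x => (f x)%:C) ->
     Rintegral mu setT (fun p => h (vec3 p) * f (vec3 p)) = 0) ->
  ae3 (fun x => h x = 0).
Proof.
move=> ih H; pose Q n : set R3 := box (fun=> - n%:R) (fun=> n%:R).
have aeQ n : {ae mu, forall p, Q n p -> h (vec3 p) = 0}.
  have : ae_eq mu (Q n) (fun p => (h (vec3 p))%:E) (cst 0%E).
    apply: integral_ae_eq => //.
    - exact: measurable_box.
    - exact: locint_integrable_box.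
    - move=> A AQ mA; rewrite integral0 -(setIidl AQ) integral_measurable0//.
      by move=> a b; exact: integral_box0.
  by apply: filterS => p /[apply] -[].
have := ae_foralln aeQ; apply: filterS => p pQ.
have [N pN] := coord_lt_nat (vec3 p).
by apply: (pQ N) => j; rewrite -ltr_norml.
Qed.

(** Pairing with real test functions separates the real and the imaginary part
    of a function, which reduces the claim to real functions. *)
Lemma is_function_unique (T : distribution3 R) (g g' : E -> R[i]) :
  is_function T g -> is_function T g' -> ae3 (fun x => g x = g' x).
Proof.
move=> [ig Tg] [ig' Tg'].
have iR : locint (fun x => complex.Re (g x)) by move=> r; case: (ig r).
have iI : locint (fun x => complex.Im (g x)) by move=> r; case: (ig r).
have iR' : locint (fun x => complex.Re (g' x)) by move=> r; case: (ig' r).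
have iI' : locint (fun x => complex.Im (g' x)) by move=> r; case: (ig' r).
have key k k' f : locint k -> locint k' -> test_function (fun x => (f x)%:C) ->
    Rintegral mu setT (fun p => k (vec3 p) * f (vec3 p)) =
    Rintegral mu setT (fun p => k' (vec3 p) * f (vec3 p)) ->
    Rintegral mu setT (fun p => (k (vec3 p) - k' (vec3 p)) * f (vec3 p)) = 0.
  move=> ik ik' tf e; have [cf _] := test_function_continuous tf.
  have [_ [r r0]] := tf.
  under eq_Rintegral do rewrite mulrBl.
  have f0 x : r < enorm x -> f x = 0 by move=> /r0 /(congr1 (@complex.Re R)).
  rewrite RintegralB//; first by rewrite e subrr.
    apply: (@locint_supp _ (fun x => k x * f x) r); first exact: (locintM ik cf).
    by move=> x /f0 ->; rewrite mulr0.
  apply: (@locint_supp _ (fun x => k' x * f x) r); first exact: (locintM ik' cf).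
  by move=> x /f0 ->; rewrite mulr0.
have eqT f : test_function (fun x => (f x)%:C) ->
   Rintegral mu setT (fun p => complex.Re (g (vec3 p)) * f (vec3 p)) =
   Rintegral mu setT (fun p => complex.Re (g' (vec3 p)) * f (vec3 p)) /\
   Rintegral mu setT (fun p => complex.Im (g (vec3 p)) * f (vec3 p)) =
   Rintegral mu setT (fun p => complex.Im (g' (vec3 p)) * f (vec3 p)).
  move=> tf; have := Tg _ tf; rewrite (Tg' _ tf) /integral3.
  under eq_Rintegral do rewrite ReM /= mulr0 subr0.
  under [X in _ +i* X]eq_Rintegral do rewrite ImM /= mulr0 add0r.
  under [in RHS]eq_Rintegral do rewrite ReM /= mulr0 subr0.
  under [X in _ = _ +i* X]eq_Rintegral do rewrite ImM /= mulr0 add0r.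
  by case=> -> ->.
have aeR := ae_zero_test (locintB iR iR') (fun f tf => key _ _ f iR iR' tf (eqT f tf).1).
have aeI := ae_zero_test (locintB iI iI') (fun f tf => key _ _ f iI iI' tf (eqT f tf).2).
have ae_filter := ae_filter_ringOfSetsType (mu : {measure set R3 -> \bar R}).
apply: (@filterS2 _ _ ae_filter) aeR aeI => p /eqP; rewrite subr_eq0 => /eqP eR /eqP.
by rewrite subr_eq0 => /eqP eI; exact: complexP.
Qed.

End Bump.

(** * Functions representing Fourier transforms of derivatives *)

Section Representation.
Variable R : realType.
Local Notation E := 'rV[R]_3.
Local Notation C := R[i].
Local Notation mR := (measurableTypeR R).
Local Notation R3 := (mR * mR * mR)%type.
Local Notation mu := (@lebesgue3 R).
Local Notation Re := complex.Re.
Local Notation Im := complex.Im.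
Implicit Types (phi f g : E -> C) (c : C) (T : distribution3 R).

Definition cintegrable f :=
  mu.-integrable setT (fun p : R3 => (Re (f (vec3 p)))%:E) /\
  mu.-integrable setT (fun p : R3 => (Im (f (vec3 p)))%:E).

Lemma integral3D f g : cintegrable f -> cintegrable g ->
  integral3 (fun x => f x + g x) = integral3 f + integral3 g.
Proof.
move=> [fR fI] [gR gI]; apply: complexP; rewrite ?(ReD, ImD) /=.
  by under eq_Rintegral do rewrite ReD; rewrite RintegralD.
by under eq_Rintegral do rewrite ImD; rewrite RintegralD.
Qed.

Lemma integrable_scale (k : R) (h : R3 -> R) :
  mu.-integrable setT (fun p => (h p)%:E) -> mu.-integrable setT (fun p => (k * h p)%:E).
Proof. by move=> ih; exact: (@integrableZl _ _ _ mu _ _ k _ ih). Qed.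

Lemma integral3Z c f : cintegrable f ->
  integral3 (fun x => c * f x) = c * integral3 f.
Proof.
move=> [fR fI]; apply: complexP; rewrite ?(ReM, ImM) /=.
  under eq_Rintegral do rewrite ReM.
  by rewrite RintegralB ?RintegralZl//; exact: integrable_scale.
under eq_Rintegral do rewrite ImM.
by rewrite RintegralD ?RintegralZl//; exact: integrable_scale.
Qed.

Lemma locintZ k (h : E -> R) : locint h -> locint (fun x => k * h x).
Proof.
move=> ih; have -> : (fun x => k * h x) = fun x => h x * k.
  by apply/funext => x; rewrite mulrC.
by apply: (locintM ih) => x; exact: cst_continuous.
Qed.

Lemma locally_integrable3P g : locally_integrable3 g <->
  locint (fun x => Re (g x)) /\ locint (fun x => Im (g x)).
Proof.
split=> [ig|[iR iI] r]; last by split; [exact: iR|exact: iI].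
by split=> r; case: (ig r).
Qed.

Lemma cintegrable_test g phi : locally_integrable3 g -> test_function phi ->
  cintegrable (fun x => g x * phi x).
Proof.
move=> /locally_integrable3P[iR iI] tphi.
have [cR cI] := test_function_continuous tphi.
have [_ [r phi0]] := tphi.
split.
  apply: (@locint_supp _ (fun x => Re (g x * phi x)) r); last first.
    by move=> x /phi0 ->; rewrite mulr0.
  have -> : (fun x => Re (g x * phi x)) =
    fun x => Re (g x) * Re (phi x) - Im (g x) * Im (phi x) by apply/funext => x; rewrite ReM.
  by apply: locintB; exact: locintM.
apply: (@locint_supp _ (fun x => Im (g x * phi x)) r); last first.
  by move=> x /phi0 ->; rewrite mulr0.
have -> : (fun x => Im (g x * phi x)) =
  fun x => Re (g x) * Im (phi x) + Im (g x) * Re (phi x) by apply/funext => x; rewrite ImM.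
by apply: locintD; exact: locintM.
Qed.

Lemma is_functionD T T' g g' : is_function T g -> is_function T' g' ->
  is_function (fun phi => T phi + T' phi) (fun x => g x + g' x).
Proof.
move=> [ig Tg] [ig' Tg']; split.
  have /locally_integrable3P[? ?] := ig; have /locally_integrable3P[? ?] := ig'.
  apply/locally_integrable3P; split.
    have -> : (fun x => Re (g x + g' x)) = fun x => Re (g x) + Re (g' x).
      by apply/funext => x; rewrite ReD.
    exact: locintD.
  have -> : (fun x => Im (g x + g' x)) = fun x => Im (g x) + Im (g' x).
    by apply/funext => x; rewrite ImD.
  exact: locintD.
move=> phi tphi; rewrite Tg// Tg'// -integral3D; [|exact: cintegrable_test..].
by congr integral3; apply/funext => x; rewrite mulrDl.
Qed.

Lemma is_functionZ c T g : is_function T g ->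
  is_function (fun phi => c * T phi) (fun x => c * g x).
Proof.
move=> [ig Tg]; split.
  have /locally_integrable3P[? ?] := ig.
  apply/locally_integrable3P; split.
    have -> : (fun x => Re (c * g x)) = fun x => Re c * Re (g x) - Im c * Im (g x).
      by apply/funext => x; rewrite ReM.
    by apply: locintB; exact: locintZ.
  have -> : (fun x => Im (c * g x)) = fun x => Re c * Im (g x) + Im c * Re (g x).
    by apply/funext => x; rewrite ImM.
  by apply: locintD; exact: locintZ.
move=> phi tphi; rewrite Tg// -integral3Z; last exact: cintegrable_test.
by congr integral3; apply/funext => x; rewrite mulrA.
Qed.

Lemma is_functionB T T' g g' : is_function T g -> is_function T' g' ->
  is_function (fun phi => T phi - T' phi) (fun x => g x - g' x).
Proof.
move=> Tg /(is_functionZ (-1)) Tg'; have := is_functionD Tg Tg'.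
rewrite (_ : (fun phi => T phi + -1 * T' phi) = fun phi => T phi - T' phi).
  rewrite (_ : (fun x => g x + -1 * g' x) = fun x => g x - g' x)//.
  by apply/funext => x; rewrite mulN1r.
by apply/funext => phi; rewrite mulN1r.
Qed.

(** The Fourier transform of the i-th derivative, when g is that of the
    distribution itself. *)
Definition partial_symbol (i : 'I_3) g : E -> C :=
  fun x => (0 +i* (2 * pi)) * (x 0 i)%:C * g x.

(** The sign in the definition of the derivative of a distribution turns the
    factor - 2 pi i x_j of fourier_partial into the symbol. *)
Lemma is_function_partial i T g : is_function (dist_fourier T) g ->
  is_function (dist_fourier (dist_partial i T)) (partial_symbol i g).
Proof.
move=> [ig Tg]; have /locally_integrable3P[iR iI] := ig; split.
  have mulx (h : E -> R) k : locint h -> locint (fun x => k * (h x * x 0 i)).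
    by move=> ih; apply/locintZ/locintM => // x; exact: continuous_coord3.
  apply/locally_integrable3P; split.
    have -> : (fun x => Re (partial_symbol i g x)) = fun x => - (2 * pi) * (Im (g x) * x 0 i).
      by apply/funext => x; rewrite /partial_symbol !(ReM, ImM)/=; ring.
    exact: mulx.
  have -> : (fun x => Im (partial_symbol i g x)) = fun x => (2 * pi) * (Re (g x) * x 0 i).
    by apply/funext => x; rewrite /partial_symbol !(ReM, ImM)/=; ring.
  exact: mulx.
move=> phi tphi; rewrite /dist_fourier /dist_partial fourier_partial//.
have tpsi := test_function_coordM (0 -i* (2 * pi)) i tphi.
have := Tg _ tpsi; rewrite /dist_fourier => ->.
rewrite -mulN1r -integral3Z; last exact: cintegrable_test.
congr integral3; apply/funext => x; rewrite /partial_symbol.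
by apply: complexP; rewrite !(ReM, ImM)/=; ring.
Qed.

End Representation.

(** * Homogeneous Sobolev norms on the Fourier side *)

Section Sobolev.
Variable R : realType.
Local Notation E := 'rV[R]_3.
Local Notation C := R[i].
Local Notation mR := (measurableTypeR R).
Local Notation R3 := (mR * mR * mR)%type.
Local Notation mu := (@lebesgue3 R).
Local Notation Re := complex.Re.
Local Notation Im := complex.Im.
Implicit Types (s : R) (g : E -> C) (T : distribution3 R).

Definition energy (I : finType) s (g : I -> E -> C) (x : E) : R :=
  \sum_i cabs (laplacian_power (s / 2) (g i) x) ^+ 2.

Definition sqabs (z : C) : R := Re z ^+ 2 + Im z ^+ 2.

Definition weight s (x : E) : R := (((2 * pi * enorm x) ^+ 2) `^ (s / 2)) ^+ 2.

Lemma energyE (I : finType) s (g : I -> E -> C) x :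
  energy s g x = weight s x * \sum_i sqabs (g i x).
Proof.
rewrite /energy mulr_sumr; apply: eq_bigr => i _.
rewrite /cabs sqr_sqrtr ?addr_ge0 ?sqr_ge0// /laplacian_power !(ReM, ImM)/=.
by rewrite /weight /sqabs; ring.
Qed.

Lemma energy_ge0 (I : finType) s (g : I -> E -> C) x : 0 <= energy s g x.
Proof. by apply: sumr_ge0 => i _; exact: sqr_ge0. Qed.

Lemma measurable_energy (I : finType) s (g : I -> E -> C) :
  (forall i, locally_integrable3 (g i)) ->
  measurable_fun setT (fun p : R3 => (energy s g (vec3 p))%:E).
Proof.
move=> ig; apply/measurable_EFinP; under eq_fun do rewrite energyE.
apply: measurable_funM.
  apply: measurable_funX.
  apply: (measurableT_comp (f := fun t : mR => t `^ (s / 2) : mR)).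
    exact: measurable_powR.
  apply: measurable_funX; apply: measurable_funM; first exact: measurable_cst.
  exact: (continuous_measurable3 (@continuous_enorm R)).
apply: measurable_sum => i; have /locally_integrable3P[iR iI] := ig i.
apply: measurable_funD; apply: measurable_funX; apply/measurable_EFinP.
  exact: (locint_measurable iR).
exact: (locint_measurable iI).
Qed.

Lemma ae3_imply (P Q : E -> Prop) : ae3 P -> (forall x, P x -> Q x) -> ae3 Q.
Proof.
move=> aeP PQ.
have ae_filter := ae_filter_ringOfSetsType (mu : {measure set R3 -> \bar R}).
apply: (@filterS _ _ ae_filter) aeP => p.
exact: PQ.
Qed.

(** The common weight factors out, so norms can be compared through sums of
    squared moduli at almost every frequency. *)
Lemma integral_energy_ae (I J : finType) s (g : I -> E -> C) (g' : J -> E -> C) :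
  (forall i, locally_integrable3 (g i)) -> (forall j, locally_integrable3 (g' j)) ->
  ae3 (fun x => \sum_i sqabs (g i x) = \sum_j sqabs (g' j x)) ->
  (\int[mu]_p (energy s g (vec3 p))%:E = \int[mu]_p (energy s g' (vec3 p))%:E)%E.
Proof.
move=> ig ig' gg'; apply: ge0_ae_eq_integral => //.
- exact: measurable_energy.
- exact: measurable_energy.
- by move=> p _; rewrite lee_fin energy_ge0.
- by move=> p _; rewrite lee_fin energy_ge0.
have ae_filter := ae_filter_ringOfSetsType (mu : {measure set R3 -> \bar R}).
apply: (@filterS _ _ ae_filter) gg' => p gg' _.
by rewrite !energyE gg'.
Qed.

(** Representatives agree almost everywhere, hence the infimum defining the
    norm is over a single value. *)
Lemma sobolev_sqnormE (I : finType) s (f : I -> distribution3 R) (g : I -> E -> C) :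
  (forall i, is_function (dist_fourier (f i)) (g i)) ->
  sobolev_sqnorm s f = (\int[mu]_p (energy s g (vec3 p))%:E)%E.
Proof.
move=> fg; rewrite /sobolev_sqnorm -[RHS]ereal_inf1; congr ereal_inf.
apply/seteqP; split => [_ [g' fg' <-]|_ ->]; last by exists g.
apply: ge0_ae_eq_integral => //.
- by apply: measurable_energy => i; case: (fg' i).
- by apply: measurable_energy => i; case: (fg i).
- by move=> p _; rewrite lee_fin; exact: energy_ge0.
- by move=> p _; rewrite lee_fin; exact: energy_ge0.
have ae i : ae3 (fun x => g' i x = g i x) by exact: is_function_unique (fg' i) (fg i).
have := @filter_forall _ _ _ _ (ae_filter_ringOfSetsType (mu : {measure set R3 -> \bar R})) ae.
apply: filterS => p gp _; congr EFin; apply: eq_bigr => i _.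
by rewrite /laplacian_power gp.
Qed.

(** * Pointwise identities at a fixed frequency *)

Section Lagrange.
Variable x : 'I_3 -> R.
Implicit Types a : 'I_3 -> R.

Definition sym_sq a := \sum_(ij : 'I_3 * 'I_3) (x ij.1 * a ij.2 + x ij.2 * a ij.1) ^+ 2.
Definition skew_sq a := \sum_(ij : 'I_3 * 'I_3) (x ij.1 * a ij.2 - x ij.2 * a ij.1) ^+ 2.
Definition cross_sq a :=
  \sum_(i : 'I_3) (x (i + 1) * a (i + 2%:R) - x (i + 2%:R) * a (i + 1)) ^+ 2.
Definition outer_sq a := \sum_(ij : 'I_3 * 'I_3) (x ij.1 * a ij.2) ^+ 2.

Lemma cross_sqE a : cross_sq a = (x 1 * a 2%:R - x 2%:R * a 1) ^+ 2 +
  (x 2%:R * a 0 - x 0 * a 2%:R) ^+ 2 + (x 0 * a 1 - x 1 * a 0) ^+ 2.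
Proof.
have e1 : 0 + 1 = 1 :> 'I_3 by exact/val_inj.
have e2 : 1 + 1 = 2%:R :> 'I_3 by exact/val_inj.
have e3 : 2%:R + 1 = 0 :> 'I_3 by exact/val_inj.
have e4 : 0 + 2%:R = 2%:R :> 'I_3 by exact/val_inj.
have e5 : 1 + 2%:R = 0 :> 'I_3 by exact/val_inj.
have e6 : 2%:R + 2%:R = 1 :> 'I_3 by exact/val_inj.
by rewrite /cross_sq sum3 e1 e2 e3 e4 e5 e6.
Qed.

(** Expand (s + t)^2 = (s - t)^2 + 4 s t with s = x_i a_j and t = x_j a_i; the
    products s t sum to the square of the inner product. *)
Lemma sym_sqE a : sym_sq a = skew_sq a + 4 * (\sum_i x i * a i) ^+ 2.
Proof.
rewrite /sym_sq /skew_sq !sum_pairs3 sum3 /=.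
move: (x 0) (x 1) (x 2%:R) (a 0) (a 1) (a 2%:R) => x0 x1 x2 a0 a1 a2; ring.
Qed.

(** Each component of the cross product occurs for two ordered pairs. *)
Lemma skew_sqE a : skew_sq a = 2 * cross_sq a.
Proof.
rewrite /skew_sq sum_pairs3 cross_sqE /=.
move: (x 0) (x 1) (x 2%:R) (a 0) (a 1) (a 2%:R) => x0 x1 x2 a0 a1 a2; ring.
Qed.

Lemma cross_sq_lagrange a : cross_sq a = outer_sq a - (\sum_i x i * a i) ^+ 2.
Proof.
rewrite /outer_sq sum_pairs3 cross_sqE sum3 /=.
move: (x 0) (x 1) (x 2%:R) (a 0) (a 1) (a 2%:R) => x0 x1 x2 a0 a1 a2; ring.
Qed.

End Lagrange.

Section Symbols.
Variables (v : 'I_3 -> C) (x : E).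
Local Notation xi := (fun i => x 0 i).
Local Notation vR := (fun j => Re (v j)).
Local Notation vI := (fun j => Im (v j)).
(** The symbol of the gradient of a field whose Fourier transform is v at the
    frequency x. *)
Let G (ij : 'I_3 * 'I_3) : C := (0 +i* (2 * pi)) * (x 0 ij.1)%:C * v ij.2.

Let ReG ij : Re (G ij) = - (2 * pi) * (x 0 ij.1 * Im (v ij.2)).
Proof. by rewrite /G !(ReM, ImM)/=; ring. Qed.

Let ImG ij : Im (G ij) = 2 * pi * (x 0 ij.1 * Re (v ij.2)).
Proof. by rewrite /G !(ReM, ImM)/=; ring. Qed.

Lemma sqabs_half z : sqabs (2^-1 * z) = 4^-1 * sqabs z.
Proof.
have -> : 2^-1 = (2^-1)%:C :> C by rewrite fmorphV rmorph_nat.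
by rewrite /sqabs ReM ImM /= !mul0r subr0 addr0; field.
Qed.

(** The frequency is real, so orthogonality splits into real and imaginary
    parts. *)
Lemma orthogonal_re_im : \sum_j (x 0 j)%:C * v j = 0 ->
  \sum_i x 0 i * Re (v i) = 0 /\ \sum_i x 0 i * Im (v i) = 0.
Proof.
rewrite !sum3 => div0.
split; [have := congr1 (@complex.Re R) div0|have := congr1 (@complex.Im R) div0];
by rewrite !(ReD, ImD, ReM, ImM)/= !mul0r ?subr0 ?addr0.
Qed.

Let sum_strain : \sum_ij sqabs (2^-1 * (G ij + G (ij.2, ij.1))) =
  pi ^+ 2 * (sym_sq xi vR + sym_sq xi vI).
Proof.
rewrite /sym_sq -big_split /= mulr_sumr; apply: eq_bigr => ij _.
by rewrite sqabs_half /sqabs ReD ImD !(ReG, ImG) /=; field.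
Qed.

Let sum_antisym : \sum_ij sqabs (2^-1 * (G ij - G (ij.2, ij.1))) =
  pi ^+ 2 * (skew_sq xi vR + skew_sq xi vI).
Proof.
rewrite /skew_sq -big_split /= mulr_sumr; apply: eq_bigr => ij _.
by rewrite sqabs_half /sqabs ReD ImD ReN ImN !(ReG, ImG) /=; field.
Qed.

Let sum_vorticity : \sum_i sqabs (G (i + 1, i + 2%:R) - G (i + 2%:R, i + 1)) =
  4 * pi ^+ 2 * (cross_sq xi vR + cross_sq xi vI).
Proof.
rewrite /cross_sq -big_split /= mulr_sumr; apply: eq_bigr => i _.
by rewrite /sqabs ReD ImD ReN ImN !(ReG, ImG) /=; ring.
Qed.

Let sum_grad : \sum_ij sqabs (G ij) = 4 * pi ^+ 2 * (outer_sq xi vR + outer_sq xi vI).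
Proof.
rewrite /outer_sq -big_split /= mulr_sumr; apply: eq_bigr => ij _.
by rewrite /sqabs ReG ImG; ring.
Qed.

Lemma sqabs_strain : \sum_j (x 0 j)%:C * v j = 0 ->
  \sum_(ij : 'I_3 * 'I_3) sqabs (2^-1 * (G ij + G (ij.2, ij.1))) =
  \sum_(ij : 'I_3 * 'I_3) sqabs (2^-1 * (G ij - G (ij.2, ij.1))).
Proof.
move=> /orthogonal_re_im[dR dI]; rewrite sum_strain sum_antisym !sym_sqE dR dI.
by rewrite expr0n mulr0 !addr0.
Qed.

Lemma sqabs_vorticity :
  \sum_(ij : 'I_3 * 'I_3) sqabs (2^-1 * (G ij - G (ij.2, ij.1))) =
  2^-1 * \sum_i sqabs (G (i + 1, i + 2%:R) - G (i + 2%:R, i + 1)).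
Proof. by rewrite sum_antisym sum_vorticity !skew_sqE; field. Qed.

Lemma sqabs_grad : \sum_j (x 0 j)%:C * v j = 0 ->
  \sum_i sqabs (G (i + 1, i + 2%:R) - G (i + 2%:R, i + 1)) =
  \sum_ij sqabs (G ij).
Proof.
move=> /orthogonal_re_im[dR dI]; rewrite sum_vorticity sum_grad !cross_sq_lagrange dR dI.
by rewrite expr0n !subr0.
Qed.

End Symbols.

End Sobolev.

(** * The isometry *)

Theorem proposition3p1 (R : realType) (alpha : R)
    (u : 'I_3 -> distribution3 R) (uhat : 'I_3 -> 'rV[R]_3 -> R[i]) :
  - (3 / 2) < alpha -> alpha < 3 / 2 ->
  (forall j, tempered (u j)) ->
  (forall j, real_valued (u j)) ->
  (forall j, is_function (dist_fourier (u j)) (uhat j)) ->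
  divergence_free uhat ->
  [/\ sobolev_sqnorm alpha (strain u) = sobolev_sqnorm alpha (antisym u),
      sobolev_sqnorm alpha (antisym u)
        = ((2^-1)%:E * sobolev_sqnorm alpha (vorticity u))%E
    & ((2^-1)%:E * sobolev_sqnorm alpha (vorticity u))%E
        = ((2^-1)%:E * sobolev_sqnorm alpha (grad u))%E].
Proof.
move=> _ _ _ _ uf div0.
pose gG (ij : 'I_3 * 'I_3) := partial_symbol ij.1 (uhat ij.2).
pose gS (ij : 'I_3 * 'I_3) := fun x => 2^-1 * (gG ij x + gG (ij.2, ij.1) x).
pose gA (ij : 'I_3 * 'I_3) := fun x => 2^-1 * (gG ij x - gG (ij.2, ij.1) x).
pose gW (i : 'I_3) := fun x => gG (i + 1, i + 2%:R) x - gG (i + 2%:R, i + 1) x.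
have hG ij : is_function (dist_fourier (grad u ij)) (gG ij).
  exact: is_function_partial.
have hS ij : is_function (dist_fourier (strain u ij)) (gS ij).
  by apply: is_functionZ; apply: is_functionD; [exact: (hG ij)|exact: (hG (ij.2, ij.1))].
have hA ij : is_function (dist_fourier (antisym u ij)) (gA ij).
  by apply: is_functionZ; apply: is_functionB; [exact: (hG ij)|exact: (hG (ij.2, ij.1))].
have hW i : is_function (dist_fourier (vorticity u i)) (gW i).
  by apply: is_functionB; [exact: (hG (i + 1, i + 2%:R))|exact: (hG (i + 2%:R, i + 1))].
rewrite (sobolev_sqnormE _ hS) (sobolev_sqnormE _ hA) (sobolev_sqnormE _ hW)
  (sobolev_sqnormE _ hG).
split.
- apply: integral_energy_ae => [i|i|]; [exact: (hS i).1|exact: (hA i).1|].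
  by apply: (ae3_imply div0) => x; exact: (@sqabs_strain R (uhat^~ x) x).
- rewrite -ge0_integralZl//.
  + apply: eq_integral => p _; rewrite -EFinM; congr EFin; rewrite !energyE mulrCA.
    by congr (_ * _); exact: (@sqabs_vorticity R (uhat^~ (vec3 p)) (vec3 p)).
  + exact: (measurable_energy _ (fun i => (hW i).1)).
  + by move=> p _; rewrite lee_fin energy_ge0.
- congr (_ * _)%E; apply: integral_energy_ae => [i|i|]; [exact: (hW i).1|exact: (hG i).1|].
  by apply: (ae3_imply div0) => x; exact: (@sqabs_grad R (uhat^~ x) x).
Qed.
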